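(* A melon graph $M=(E_1,\ldots,E_m)$ with endpoints $0$ and $0'$ is a comparability graph if and only if one of the following holds: 1. all constituent paths of $M$ have the same parity (i.e. their lengths are all even or all odd); 2. the endpoints $0$ and $0'$ are adjacent, and all constituent paths of even length are of length two.
   Context: All graphs are finite and simple. A melon graph $M=(E_1,\ldots,E_m)$ ($m\ge 1$) is the graph formed as the union of $m$ paths $E_1,\ldots,E_m$ (the constituent paths), all having the same two distinct endpoints $0$ and $0'$, and pairwise sharing no vertices other than $0$ and $0'$; since $M$ is simple, at most one constituent path has length one (length = number of edges). The parity of a path is the parity of its length. A comparability graph is a graph that admits a transitive orientation, i.e. an assignment of a direction to each edge such that the adjacency relation of the resulting directed graph is transitive. *)

(* Defs.v *)
From mathcomp Require Import all_boot.

Set Implicit Arguments.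
Unset Strict Implicit.
Unset Printing Implicit Defensive.

(* A finite simple graph is a symmetric irreflexive adjacency relation
   [e : rel V] on a finite type [V] of vertices. *)
Definition simple_graph (V : finType) (e : rel V) : Prop :=
  symmetric e /\ irreflexive e.

(* As in the path library, a path is given by its first vertex [x] and the
   sequence [p] of the vertices that follow, so its length is [size p]. *)
Definition path_edge (V : finType) (x : V) (p : seq V) : rel V :=
  fun u v => ((u, v) \in zip (x :: p) p) || ((v, u) \in zip (x :: p) p).

(* The constituent path [E i] is listed from [o] (excluded) to [o'] (included). *)
Record melon_graph (V : finType) (e : rel V) (o o' : V)
    (m : nat) (E : 'I_m -> seq V) : Prop := MelonGraph {
  melon_simple : simple_graph e;
  melon_gt0 : 0 < m;
  melon_neq : o != o';
  melon_uniq : forall i, uniq (o :: E i);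
  melon_last : forall i, last o (E i) = o';
  melon_disjoint : forall i j v, i != j ->
    v \in o :: E i -> v \in o :: E j -> v = o \/ v = o';
  (* not implied by [melon_simple]: [e] cannot record edge multiplicities *)
  melon_length1 : forall i j, size (E i) = 1 -> size (E j) = 1 -> i = j;
  melon_vertex : forall v, exists i, v \in o :: E i;
  melon_edge : forall u v, e u v <-> exists i, path_edge o (E i) u v
}.

Definition orientation (V : finType) (e r : rel V) : Prop :=
  subrel r e /\ (forall u v, e u v -> r u v (+) r v u).

Definition comparability_graph (V : finType) (e : rel V) : Prop :=
  exists r : rel V, orientation e r /\ transitive r.

(* Main.v *)
Require Import Defs.
From mathcomp Require Import all_boot zify.

Set Implicit Arguments.
Unset Strict Implicit.
Unset Printing Implicit Defensive.

(** In a transitive orientation [r], two edges [uv] and [vw] with [u] and [w]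
    not adjacent both point into [v] or both point out of [v]. Inside a
    constituent path this makes directions alternate, the only possible
    exception being the middle of a path of length two when the endpoints are
    adjacent; so a path of length [L] relates the directions of its two extreme
    edges by the parity of [L] ([alternating_ends]).

    Necessity. If the endpoints are not adjacent, all first edges leave [o]
    alike, and all last edges leave [o'] alike, since internal vertices of
    distinct paths are not adjacent; hence all lengths have the same parity. If
    they are adjacent, the edge [o o'] agrees with both extreme edges of any
    path of length at least three, and since it has opposite directions as seen
    from [o] and from [o'], that length is odd.

    Sufficiency. Orienting every edge towards the larger value of a ranking of
    the vertices is transitive as soon as monotone two-step walks have adjacent
    ends ([ranking_comparability]). If all parities agree, the rank is the
    parity of the distance to [o] along a path, that is, a bipartition, and
    there is no monotone two-step walk. In the other case the rank of [o'] is
    raised to 2; then the only monotone two-step walks are the paths of length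
    two from [o] to [o'], whose ends are adjacent. *)

(** * Transitive orientations *)

(** Directing each edge towards its end of higher rank leaves transitivity to be
    checked only on rank-increasing walks. *)
Lemma ranking_comparability (V : finType) (e : rel V) (f : V -> nat) :
    symmetric e -> (forall u v, e u v -> f u != f v) ->
    (forall u v w, e u v -> e v w -> f u < f v -> f v < f w -> e u w) ->
  comparability_graph e.
Proof.
move=> e_sym f_edge f_mono; exists (fun u v => e u v && (f u < f v)).
split; last first.
  move=> v u w /andP[euv ltuv] /andP[evw ltvw].
  by rewrite (f_mono u v w) // (ltn_trans ltuv).
split=> [u v /andP[] //|u v euv].
by rewrite (e_sym v u) euv /=; move: (f_edge _ _ euv); case: ltngtP.
Qed.

Lemma orientation_flip (V : finType) (e r : rel V) (u v : V) :
  orientation e r -> e u v -> r v u = ~~ r u v.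
Proof. by case=> _ xor_r /xor_r; case: (r u v); case: (r v u). Qed.

(** If one edge pointed into [v] and the other out of it, transitivity would
    direct an edge between [u] and [w]. *)
Lemma transitive_orientation_nonadj (V : finType) (e r : rel V) (u v w : V) :
    symmetric e -> orientation e r -> transitive r ->
    e v u -> e v w -> ~~ e u w -> r v u = r v w.
Proof.
move=> e_sym r_or r_tr evu evw neuw.
have sub_re : subrel r e by case: r_or.
have := orientation_flip r_or evu; have := orientation_flip r_or evw.
have: ~~ (r u v && r v w).
  by apply: contra neuw => /andP[ruv rvw]; apply/sub_re/(r_tr v).
have: ~~ (r w v && r v u).
  apply: contra neuw => /andP[rwv rvu]; rewrite e_sym.
  exact/sub_re/(r_tr v).
by case: (r v u); case: (r v w) => /= + + Ewv Euv; rewrite Ewv Euv.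
Qed.

(** * Positions on the constituent paths *)

Lemma path_edgeP (V : finType) (x : V) (p : seq V) (u v : V) :
  path_edge x p u v <->
  exists2 k, k < size p &
    (u = nth x (x :: p) k /\ v = nth x (x :: p) k.+1) \/
    (v = nth x (x :: p) k /\ u = nth x (x :: p) k.+1).
Proof.
have zipP a b : reflect
    (exists2 k, k < size p & a = nth x (x :: p) k /\ b = nth x (x :: p) k.+1)
    ((a, b) \in zip (x :: p) p).
  have sz : size (zip (x :: p) p) = size p.
    by rewrite size_zip; apply/minn_idPr => /=.
  have nth_zp k : k < size p ->
      nth (x, x) (zip (x :: p) p) k = (nth x (x :: p) k, nth x p k).
    by move=> ltk; rewrite nth_zip_cond sz ltk.
  apply: (iffP (nthP (x, x))); rewrite sz => -[k ltk].
    by rewrite nth_zp // => -[<- <-]; exists k.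
  by case=> -> ->; exists k; rewrite // nth_zp.
split=> [/orP[] /zipP[k ltk Ek]|[k ltk [Ek|Ek]]].
- by exists k => //; left.
- by exists k => //; right.
- by apply/orP; left; apply/zipP; exists k.
- by apply/orP; right; apply/zipP; exists k.
Qed.

Section Melon.

Context (V : finType) (e : rel V) (o o' : V) (m : nat) (E : 'I_m -> seq V).
Hypothesis hM : melon_graph e o o' E.

Local Notation P i k := (nth o (o :: E i) k).

Let e_sym : symmetric e := proj1 (melon_simple hM).

Lemma pos_last i : P i (size (E i)) = o'.
Proof. by rewrite -(melon_last hM i) -nth_last; case: (E i). Qed.

Lemma length_gt0 i : 0 < size (E i).
Proof.
by rewrite lt0n; apply: contra (melon_neq hM) => /eqP s0;
  rewrite -(pos_last i) s0.
Qed.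

Lemma pos_inj i k l :
  k <= size (E i) -> l <= size (E i) -> P i k = P i l -> k = l.
Proof.
by move=> lek lel /eqP; rewrite nth_uniq ?(melon_uniq hM) // => /eqP.
Qed.

(** A vertex determines its path and its position there, except for the two
    endpoints, each of which has the same role on every path. *)
Lemma pos_eq i j k l :
    k <= size (E i) -> l <= size (E j) -> P i k = P j l ->
  [\/ i = j /\ k = l, k = 0 /\ l = 0 | k = size (E i) /\ l = size (E j)].
Proof.
move=> lek lel Ekl; have [eqij|neqij] := eqVneq i j.
  by subst j; constructor 1; split=> //; apply: pos_inj Ekl.
have memi : P i k \in o :: E i by rewrite mem_nth.
have memj : P i k \in o :: E j by rewrite Ekl mem_nth.
have [P0|P1] := melon_disjoint hM neqij memi memj.
  by constructor 2; split; [apply: (@pos_inj i)|apply: (@pos_inj j)];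
    rewrite // -?Ekl P0.
by constructor 3; split; [apply: (@pos_inj i)|apply: (@pos_inj j)];
  rewrite // -?Ekl P1 pos_last.
Qed.

Lemma edgeP u v :
  e u v <-> exists i k, k < size (E i) /\
    ((u = P i k /\ v = P i k.+1) \/ (v = P i k /\ u = P i k.+1)).
Proof.
rewrite (melon_edge hM); split=> [[i /path_edgeP[k ltk Euv]]|[i [k [ltk Euv]]]].
  by exists i, k.
by exists i; apply/path_edgeP; exists k.
Qed.

Lemma pos_edge i k : k < size (E i) -> e (P i k) (P i k.+1).
Proof. by move=> ltk; apply/edgeP; exists i, k; split=> //; left. Qed.

(** The internal vertices of the paths have degree two; every non-adjacency
    used below follows from this. *)
Lemma internal_neighbour i k v : 0 < k < size (E i) -> e (P i k) v ->
  v = P i k.-1 \/ v = P i k.+1.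
Proof.
move=> /andP[k_gt0 ltk] /edgeP[j [l [ltl [] [Ek Ev]]]].
  have [||[eqij eqkl]|[]|[]] := pos_eq _ _ Ek; try lia.
  by subst j l; right.
rewrite {}Ek.
have [||[eqij eqkl]|[]|[]] := pos_eq _ _ Ev; try lia.
by subst j k; left.
Qed.

Lemma skip_nonadj i k : k.+2 <= size (E i) ->
  2 < size (E i) \/ ~~ e o o' -> ~~ e (P i k) (P i k.+2).
Proof.
move=> lek Hi; apply/negP => eP.
have [ltk|gek] := ltnP k.+2 (size (E i)).
  move: eP; rewrite e_sym => /internal_neighbour [|/pos_inj|/pos_inj]; lia.
have [k0|k_gt0] := posnP k.
  case: Hi => [|/negP[]]; first lia.
  move: eP; rewrite k0; have -> : 2 = size (E i) by lia.
  by rewrite pos_last.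
by move: eP => /internal_neighbour [|/pos_inj|/pos_inj]; lia.
Qed.

Lemma internal_nonadj i j k l : i != j ->
  0 < k < size (E i) -> 0 < l < size (E j) -> ~~ e (P i k) (P j l).
Proof.
move=> /eqP neqij lk ll; apply/negP => /(internal_neighbour lk) [] Ejl.
  by have [||[/esym/neqij[]]|[]|[]] := pos_eq _ _ Ejl; lia.
by have [||[/esym/neqij[]]|[]|[]] := pos_eq _ _ Ejl; lia.
Qed.

Lemma first_edge i : e o (P i 1).
Proof. exact: pos_edge (length_gt0 i). Qed.

Lemma last_edge i : e o' (P i (size (E i)).-1).
Proof.
rewrite e_sym -[X in e _ X](pos_last i) -{2}(prednK (length_gt0 i)).
by apply: pos_edge; rewrite prednK ?length_gt0.
Qed.

(** * Necessity *)

(** Directions alternate along the path, so its [k]-th edge, directed forwards,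
    agrees with its first one up to the parity of [k]; the last edge is then
    read backwards, from [o']. *)
Lemma alternating_ends (r : rel V) i :
    orientation e r -> transitive r -> 2 < size (E i) \/ ~~ e o o' ->
  r o' (P i (size (E i)).-1) = r o (P i 1) (+) odd (size (E i)).
Proof.
move=> r_or r_tr Hi.
have alt k : k < size (E i) -> r (P i k) (P i k.+1) = r o (P i 1) (+) odd k.
  elim: k => [|k IHk] ltk; first by rewrite addbF.
  have ek := pos_edge (ltnW ltk); have eSk := pos_edge ltk.
  have ek' : e (P i k.+1) (P i k) by rewrite e_sym.
  rewrite -(transitive_orientation_nonadj e_sym r_or r_tr ek' eSk);
    last exact: skip_nonadj.
  by rewrite (orientation_flip r_or ek) IHk ?(ltnW ltk) // addbN.
have s_gt0 := length_gt0 i.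
have lts : (size (E i)).-1 < size (E i) by rewrite prednK.
have := orientation_flip r_or (pos_edge lts).
by rewrite alt // prednK // pos_last -addbN => ->; rewrite -{2}(prednK s_gt0).
Qed.

Lemma comparability_nonadj_parity i j :
  comparability_graph e -> ~~ e o o' -> odd (size (E i)) = odd (size (E j)).
Proof.
move=> [r [r_or r_tr]] neoo'; have [->//|neqij] := eqVneq i j.
have size_gt1 h : 1 < size (E h).
  rewrite ltn_neqAle length_gt0 andbT; apply: contra neoo' => /eqP s1.
  by have := first_edge h; rewrite s1 pos_last.
have Ei := alternating_ends r_or r_tr (or_intror neoo' : 2 < size (E i) \/ _).
have Ej := alternating_ends r_or r_tr (or_intror neoo' : 2 < size (E j) \/ _).
have Efirst : r o (P i 1) = r o (P j 1).
  apply: (transitive_orientation_nonadj e_sym r_or r_tr);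
    by rewrite ?first_edge ?internal_nonadj ?size_gt1.
have Elast : r o' (P i (size (E i)).-1) = r o' (P j (size (E j)).-1).
  apply: (transitive_orientation_nonadj e_sym r_or r_tr);
    rewrite ?last_edge ?internal_nonadj //.
    by have := size_gt1 i; lia.
  by have := size_gt1 j; lia.
by apply: (@addbI (r o (P i 1))); rewrite -Ei Elast Ej Efirst.
Qed.

(** On a longer path, the first edge has the direction of [o o'] as seen from
    [o], the last one that of [o o'] as seen from [o']; these are opposite, so
    the length cannot be even. *)
Lemma comparability_adj_even_length i :
    comparability_graph e -> e o o' ->
  ~~ odd (size (E i)) -> size (E i) = 2.
Proof.
move=> [r [r_or r_tr]] eoo' even_i.
have s_gt0 := length_gt0 i.
have [s_le2|s_gt2] := leqP (size (E i)) 2; first by lia.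
have := alternating_ends r_or r_tr (or_introl s_gt2 : _ \/ ~~ e o o').
rewrite (negbTE even_i) addbF.
have -> : r o (P i 1) = r o o'.
  apply: (transitive_orientation_nonadj e_sym r_or r_tr);
    rewrite ?first_edge // -(pos_last i).
  by apply/negP => /internal_neighbour [|/pos_inj|/pos_inj]; lia.
have -> : r o' (P i (size (E i)).-1) = r o' o.
  apply: (transitive_orientation_nonadj e_sym r_or r_tr);
    rewrite ?last_edge // 1?e_sym //.
  rewrite e_sym.
  by apply/negP => /(@internal_neighbour i _ (P i 0)) [|/pos_inj|/pos_inj]; lia.
by rewrite (orientation_flip r_or eoo'); case: (r o o').
Qed.

(** * Sufficiency *)

(** Quantifying over the paths through [v] avoids a choice of path. Only at
    [o'] can the parity depend on that choice. *)
Definition odd_pos v :=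
  [exists i, (v \in o :: E i) && odd (index v (o :: E i))].

Lemma odd_posP i k : k <= size (E i) ->
    k < size (E i) \/ (forall j, odd (size (E i)) = odd (size (E j))) ->
  odd_pos (P i k) = odd k.
Proof.
move=> lek Hk; apply/existsP/idP => [[j /andP[memj]]|odd_k]; last first.
  by exists i; rewrite mem_nth // index_uniq ?(melon_uniq hM).
have lej : index (P i k) (o :: E j) <= size (E j).
  by rewrite -ltnS -[(size _).+1]/(size (o :: E j)) index_mem.
have := pos_eq lek lej (esym (nth_index o memj)).
case=> [[_ <-]//|[-> ->]//|[Ek ->]].
by case: Hk => [|Hpar]; [lia|rewrite Ek (Hpar j)].
Qed.

Lemma comparability_same_parity :
    (forall i j, odd (size (E i)) = odd (size (E j))) ->
  comparability_graph e.
Proof.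
move=> Hpar; apply: (ranking_comparability (f := odd_pos)) => //.
  move=> u v /edgeP[i [k [ltk [] [-> ->]]]];
  by rewrite !(@odd_posP i) ?(ltnW ltk) //=; auto; case: (odd k).
by move=> u v w _ _; case: (odd_pos u); case: (odd_pos v); case: (odd_pos w).
Qed.

(** The vertices other than [o'] become sources at even positions and sinks at
    odd ones, except for the middle vertices of the paths of length two, which
    have [o] below them and the sink [o'] above. *)
Lemma comparability_adj :
    e o o' -> (forall i, ~~ odd (size (E i)) -> size (E i) = 2) ->
  comparability_graph e.
Proof.
move=> eoo' Heven; pose f v := if v == o' then 2 else odd_pos v : nat.
have f_pos i k : k < size (E i) -> f (P i k) = odd k.
  move=> ltk; rewrite /f odd_posP; [|exact: ltnW|by left].
  by case: eqP => //; rewrite -(pos_last i) => /pos_inj; lia.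
have f_last : f o' = 2 by rewrite /f eqxx.
have f_lt2 v : v != o' -> f v < 2.
  by rewrite /f => /negbTE ->; case: (odd_pos v).
apply: (ranking_comparability (f := f)) => //.
  have f_edge i k : k < size (E i) -> f (P i k) != f (P i k.+1).
    move=> ltk; rewrite f_pos //.
    have [ltSk|geSk] := ltnP k.+1 (size (E i)).
      by rewrite f_pos //=; case: (odd k).
    have -> : k.+1 = size (E i) by lia.
    by rewrite pos_last f_last; case: (odd k).
  move=> u v /edgeP[i [k [ltk [] [-> ->]]]]; last rewrite eq_sym; exact: f_edge.
move=> u v w euv evw fuv fvw.
(* A monotone two-step walk takes the values 0, 1, 2, so it ends at [o'] through
   a vertex [v] in odd position [k] next to it, on a path of even length. *)
have Ew : w = o' by apply/eqP; apply: contraTT fvw => /f_lt2; lia.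
have [i [k [ltk [Ev Ew']]]] : exists i k,
    k < size (E i) /\ v = P i k /\ o' = P i k.+1.
  move: evw; rewrite Ew => /edgeP[i [k [ltk [[Ev Eo']|[Eo' Ev]]]]].
    by exists i, k.
  by move: (f_pos i k ltk); rewrite -Eo' f_last; case: (odd k).
have Ek : k.+1 = size (E i) by apply: (@pos_inj i); rewrite ?pos_last.
have odd_k : odd k.
  by move: fuv; rewrite Ev f_pos //; case: (odd k).
have Ei : size (E i) = 2 by apply: Heven; rewrite -Ek /= odd_k.
have {}Ek : k = 1 by lia.
move: euv; rewrite e_sym Ev Ek => /internal_neighbour []; first by rewrite Ei.
  by rewrite Ew => ->.
have -> : 1.+1 = size (E i) by rewrite Ei.
by rewrite pos_last => Eu; move: fuv fvw; rewrite Eu f_last Ew; lia.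
Qed.

End Melon.

Theorem theorem4 (V : finType) (e : rel V) (o o' : V)
    (m : nat) (E : 'I_m -> seq V) (hM : melon_graph e o o' E) :
  comparability_graph e <->
  (forall i j : 'I_m, odd (size (E i)) = odd (size (E j))) \/
  (e o o' /\ forall i : 'I_m, ~~ odd (size (E i)) -> size (E i) = 2).
Proof.
split=> [comp_e|[Hpar|[eoo' Heven]]].
- have [eoo'|neoo'] := boolP (e o o').
    by right; split=> // i; apply: (comparability_adj_even_length hM).
  by left=> i j; apply: (comparability_nonadj_parity hM).
- exact: (comparability_same_parity hM).
- exact: (comparability_adj hM).
Qed.
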